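(* For every simple number $n>1$ there is an equational proof that every $n$-ring is commutative.
   Context: A natural number $n>1$ is called simple if every prime power $q$ (that is, $q=\ell^d$ with $\ell$ prime and $d\ge 1$) with $q-1\mid n-1$ is actually a prime number. Rings are associative and unital, not necessarily commutative; the zero ring is allowed. For an integer $n>1$, an $n$-ring is a ring in which $x^n=x$ holds for every element $x$. Equational proofs. An algebraic theory $\mathcal{T}$ is given by operation symbols of finite arities and a set of axioms, each an equation between terms. An equational proof of $\sigma=\tau$ in $\mathcal{T}$ (written $\mathcal{T}\vdash\sigma=\tau$) is a deduction by the rules: (1) if $\sigma=\tau$ is an axiom then $\mathcal{T}\vdash\sigma=\tau$; (2) $\mathcal{T}\vdash\sigma=\sigma$; (3) if $\mathcal{T}\vdash\sigma=\tau$ then $\mathcal{T}\vdash\tau=\sigma$; (4) if $\mathcal{T}\vdash\sigma=\tau$ and $\mathcal{T}\vdash\tau=\rho$ then $\mathcal{T}\vdash\sigma=\rho$; (5) if $\rho$ is a term of arity $r$ and $\mathcal{T}\vdash\sigma_i=\tau_i$ for $i=1,\dots,r$, then $\mathcal{T}\vdash\rho(\sigma_1,\dots,\sigma_r)=\rho(\tau_1,\dots,\tau_r)$; (6) if $\sigma,\tau$ are terms of arity $r$ with $\mathcal{T}\vdash\sigma=\tau$, then $\mathcal{T}\vdash\sigma(\rho_1,\dots,\rho_r)=\tau(\rho_1,\dots,\rho_r)$ for all terms $\rho_1,\dots,\rho_r$. The theory of $n$-rings consists of the ring axioms (operations $+,-,0,\cdot,1$) together with the axiom $x^n=x$. ''There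 is an equational proof that every $n$-ring is commutative'' means that this theory proves $xy=yx$ for two distinct variables $x,y$. *)

(* Defs.v *)
From mathcomp Require Import all_boot.

Set Implicit Arguments.
Unset Strict Implicit.
Unset Printing Implicit Defensive.

Definition prime_power (q : nat) : Prop :=
  exists l d : nat, [/\ prime l, 1 <= d & q = l ^ d].

Definition simple_number (n : nat) : Prop :=
  1 < n /\ forall q : nat, prime_power q -> q - 1 %| n - 1 -> prime q.

Record signature := Signature {
  operation : Type;
  arity : operation -> nat
}.

(* [term S r]: terms of arity [r], i.e. in the variables x_0, ..., x_(r-1). *)
Inductive term (S : signature) (r : nat) : Type :=
| Var of 'I_r
| App (o : operation S) of ('I_(arity o) -> term S r).

Arguments Var {S r} _.
Arguments App {S r} o _.

(* [subst t a] is the composite term t(a_0, ..., a_(r-1)). *)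
Fixpoint subst (S : signature) (r s : nat) (t : term S r)
    (a : 'I_r -> term S s) : term S s :=
  match t with
  | Var i => a i
  | App o args => App o (fun j => subst (args j) a)
  end.

Record theory := Theory {
  theory_sig :> signature;
  axiom : forall r : nat, term theory_sig r -> term theory_sig r -> Prop
}.

Inductive provable (T : theory) :
    forall r : nat, term T r -> term T r -> Prop :=
| provable_axiom r (u v : term T r) : axiom u v -> provable u v
| provable_refl r (u : term T r) : provable u u
| provable_sym r (u v : term T r) : provable u v -> provable v u
| provable_trans r (u v w : term T r) :
    provable u v -> provable v w -> provable u w
| provable_congr r s (w : term T r) (a b : 'I_r -> term T s) :
    (forall i, provable (a i) (b i)) -> provable (subst w a) (subst w b)
| provable_subst r s (u v : term T r) (a : 'I_r -> term T s) :
    provable u v -> provable (subst u a) (subst v a).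

Inductive ring_op := Add | Opp | Zero | Mul | One.

Definition ring_arity (o : ring_op) : nat :=
  match o with
  | Add | Mul => 2
  | Opp => 1
  | Zero | One => 0
  end.

Definition ring_sig : signature := Signature ring_arity.

Section RingTerms.
Variable r : nat.
Implicit Types t u : term ring_sig r.

Definition tadd t u : term ring_sig r :=
  @App ring_sig r Add (tnth [tuple t; u]).
Definition topp t : term ring_sig r := @App ring_sig r Opp (tnth [tuple t]).
Definition tzero : term ring_sig r := @App ring_sig r Zero (tnth [tuple]).
Definition tmul t u : term ring_sig r :=
  @App ring_sig r Mul (tnth [tuple t; u]).
Definition tone : term ring_sig r := @App ring_sig r One (tnth [tuple]).

(* t * (t * (... * t)) with n factors; the bracketing is immaterial in the
   presence of associativity. *)
Definition tpow t (n : nat) : term ring_sig r := iterop n tmul t tone.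

End RingTerms.

Arguments tzero {r}.
Arguments tone {r}.

(* The variables x, y, z are x_0, x_1, x_2; the bound on the index is checked
   by computation, so [r] must be a concrete numeral. *)
Notation tvar r i := (@Var ring_sig r (@Ordinal r i isT)).

Inductive nring_axiom (n : nat) :
    forall r : nat, term ring_sig r -> term ring_sig r -> Prop :=
| nring_addA (x := tvar 3 0) (y := tvar 3 1) (z := tvar 3 2) :
    nring_axiom n (tadd x (tadd y z)) (tadd (tadd x y) z)
| nring_addC (x := tvar 2 0) (y := tvar 2 1) :
    nring_axiom n (tadd x y) (tadd y x)
| nring_add0 (x := tvar 1 0) : nring_axiom n (tadd tzero x) x
| nring_addN (x := tvar 1 0) : nring_axiom n (tadd (topp x) x) tzero
| nring_mulA (x := tvar 3 0) (y := tvar 3 1) (z := tvar 3 2) :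
    nring_axiom n (tmul x (tmul y z)) (tmul (tmul x y) z)
| nring_mul1l (x := tvar 1 0) : nring_axiom n (tmul tone x) x
| nring_mul1r (x := tvar 1 0) : nring_axiom n (tmul x tone) x
| nring_mulDl (x := tvar 3 0) (y := tvar 3 1) (z := tvar 3 2) :
    nring_axiom n (tmul (tadd x y) z) (tadd (tmul x z) (tmul y z))
| nring_mulDr (x := tvar 3 0) (y := tvar 3 1) (z := tvar 3 2) :
    nring_axiom n (tmul x (tadd y z)) (tadd (tmul x y) (tmul x z))
| nring_pow (x := tvar 1 0) : nring_axiom n (tpow x n) x.

Definition nring_theory (n : nat) : theory := Theory (nring_axiom n).

(* Main.v *)
Require Import Defs.
From mathcomp Require Import all_boot.
From HB Require Import structures.
From mathcomp Require Import all_fingroup all_algebra all_solvable all_field.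
From mathcomp Require Import ring boolp.

(* By completeness of equational logic it suffices that every n-ring R (here:
   terms modulo provability) is commutative. R is reduced, so idempotents are
   central, and the characteristic of R divides 2^n - 2 and is squarefree; hence
   we may pass to the quotients R/Ann(c) of prime characteristic p. There the
   minimal polynomial g over F_p of an element x is squarefree, and for an
   irreducible factor h of g the field F_p[X]/(h) of order q satisfies y^n = y,
   so that q - 1 divides n - 1; as n is simple, q = p and h divides X^p - X.
   Thus x^p = x, and Lagrange interpolation writes x as an F_p-linear
   combination of the idempotents 1 - (x - a)^(p-1). *)

Set Implicit Arguments.
Unset Strict Implicit.
Unset Printing Implicit Defensive.

Import GRing.Theory.
Local Open Scope ring_scope.

(** * Rings as quotients by a congruence *)

Section QuotientRing.
Variables (T : Type) (E : T -> T -> Prop).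
Variables (zero one : T) (opp : T -> T) (add mul : T -> T -> T).
Hypotheses (Erefl : forall x, E x x) (Esym : forall x y, E x y -> E y x)
  (Etrans : forall x y z, E x y -> E y z -> E x z).
Hypotheses (Eopp : forall x x', E x x' -> E (opp x) (opp x'))
  (Eadd : forall x x' y y', E x x' -> E y y' -> E (add x y) (add x' y'))
  (Emul : forall x x' y y', E x x' -> E y y' -> E (mul x y) (mul x' y')).
Hypotheses (EaddA : forall x y z, E (add x (add y z)) (add (add x y) z))
  (EaddC : forall x y, E (add x y) (add y x))
  (Eadd0 : forall x, E (add zero x) x)
  (EaddN : forall x, E (add (opp x) x) zero)
  (EmulA : forall x y z, E (mul x (mul y z)) (mul (mul x y) z))
  (Emul1l : forall x, E (mul one x) x)
  (Emul1r : forall x, E (mul x one) x)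
  (EmulDl : forall x y z, E (mul (add x y) z) (add (mul x z) (mul y z)))
  (EmulDr : forall x y z, E (mul x (add y z)) (add (mul x y) (mul x z))).

(** Serves twice: for terms modulo provability, and for a ring modulo the annihilator of an integer.
    The operations act on chosen representatives, and the congruence hypotheses make the choice
    immaterial. *)
Lemma quotient_ring : exists (R : pzRingType) (f : T -> R),
  [/\ forall x y, E x y <-> f x = f y, forall r, exists x, r = f x,
      f one = 1, {morph f : x y / add x y >-> x + y} &
      {morph f : x y / mul x y >-> x * y}].
Proof.
pose C : choiceType := {classic T}.
pose e : rel C := fun x y => asbool (E x y).
have e_refl : reflexive e by move=> x; apply/asboolP.
have e_sym : symmetric e.
  by move=> x y; apply/asboolP/asboolP; apply: Esym.
have e_trans : transitive e.
  move=> y x z /asboolP xy /asboolP yz; apply/asboolP.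
  exact: Etrans xy yz.
pose eT := EquivRel e e_refl e_sym e_trans.
pose Q : choiceType := {eq_quot eT}%qT.
pose f (x : T) : Q := (\pi_({eq_quot eT}) x)%qT.
pose r (q : Q) : T := generic_quotient.repr (q : {eq_quot eT}%qT).
have fP x y : E x y <-> f x = f y.
  by split=> [Exy | /eqmodP /asboolP //]; apply/eqmodP/asboolP.
have rK q : f (r q) = q by apply: reprK.
have Er x : E (r (f x)) x by apply/fP; rewrite rK.
pose addq p q := f (add (r p) (r q)).
pose mulq p q := f (mul (r p) (r q)).
pose oppq p := f (opp (r p)).
have fadd x y : f (add x y) = addq (f x) (f y).
  by apply/fP/Eadd; apply/Esym.
have fmul x y : f (mul x y) = mulq (f x) (f y).
  by apply/fP/Emul; apply/Esym.
have fopp x : f (opp x) = oppq (f x) by apply/fP/Eopp; apply/Esym.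
have addqA : associative addq.
  by move=> x y z; rewrite -[x]rK -[y]rK -[z]rK -!fadd; apply/fP.
have addqC : commutative addq.
  by move=> x y; rewrite -[x]rK -[y]rK -!fadd; apply/fP.
have add0q : left_id (f zero) addq.
  by move=> x; rewrite -[x]rK -!fadd; apply/fP.
have addNq : left_inverse (f zero) oppq addq.
  by move=> x; rewrite -[x]rK -fopp -!fadd; apply/fP.
have mulqA : associative mulq.
  by move=> x y z; rewrite -[x]rK -[y]rK -[z]rK -!fmul; apply/fP.
have mul1q : left_id (f one) mulq.
  by move=> x; rewrite -[x]rK -!fmul; apply/fP.
have mulq1 : right_id (f one) mulq.
  by move=> x; rewrite -[x]rK -!fmul; apply/fP.
have mulqDl : left_distributive mulq addq.
  by move=> x y z; rewrite -[x]rK -[y]rK -[z]rK -!(fadd, fmul); apply/fP.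
have mulqDr : right_distributive mulq addq.
  by move=> x y z; rewrite -[x]rK -[y]rK -[z]rK -!(fadd, fmul); apply/fP.
pose R : pzRingType := HB.pack (Choice.sort Q)
  (GRing.isPzRing.Build Q addqA addqC add0q addNq mulqA mul1q mulq1
    mulqDl mulqDr).
by exists R, f; split=> // q; exists (r q); rewrite rK.
Qed.

End QuotientRing.

(** * Substitution and the term model *)

Lemma subst_tadd r s (t u : term ring_sig r) (a : 'I_r -> term ring_sig s) :
  subst (tadd t u) a = tadd (subst t a) (subst u a).
Proof. by congr App; apply: funext => -[[|[|[]]] ?]. Qed.

Lemma subst_tmul r s (t u : term ring_sig r) (a : 'I_r -> term ring_sig s) :
  subst (tmul t u) a = tmul (subst t a) (subst u a).
Proof. by congr App; apply: funext => -[[|[|[]]] ?]. Qed.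

Lemma subst_topp r s (t : term ring_sig r) (a : 'I_r -> term ring_sig s) :
  subst (topp t) a = topp (subst t a).
Proof. by congr App; apply: funext => -[[|[]] ?]. Qed.

Lemma subst_tzero r s (a : 'I_r -> term ring_sig s) : subst tzero a = tzero.
Proof. by congr App; apply: funext => -[]. Qed.

Lemma subst_tone r s (a : 'I_r -> term ring_sig s) : subst tone a = tone.
Proof. by congr App; apply: funext => -[]. Qed.

Lemma subst_tpow r s (t : term ring_sig r) (a : 'I_r -> term ring_sig s) n :
  subst (tpow t n) a = tpow (subst t a) n.
Proof.
case: n => [|n]; first exact: subst_tone.
by rewrite /tpow /iterop; elim: n => // n IH; rewrite !iteriS subst_tmul IH.
Qed.

Definition subst_ring :=
  (subst_tadd, subst_tmul, subst_topp, subst_tzero, subst_tone, subst_tpow).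

(** The completeness argument: each element of the quotient is the class of a term, so instances of
    the axiom x^n = x give the power law on the whole ring. *)
Lemma free_nring (n r : nat) :
  exists (R : pzRingType) (f : term ring_sig r -> R),
  [/\ forall x : R, x ^+ n = x, {morph f : t u / tmul t u >-> t * u} &
      forall t u, f t = f u -> @provable (nring_theory n) r t u].
Proof.
pose E := @provable (nring_theory n) r.
(* Lists encode assignments of terms to variables; the default [tzero] makes the hypothesis of
   [congr] trivial beyond the end of the lists. *)
pose v (ts : seq (term ring_sig r)) k (i : 'I_k) := nth tzero ts i.
have inst k (t u : term ring_sig k) (ts : seq (term ring_sig r)) :
    nring_axiom n t u -> E (subst t (@v ts k)) (subst u (@v ts k)).
  by move=> tu; apply/(@provable_subst (nring_theory n))/provable_axiom.
have congr k (w : term ring_sig k) (ts us : seq (term ring_sig r)) :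
    (forall i, E (nth tzero ts i) (nth tzero us i)) ->
    E (subst w (@v ts k)) (subst w (@v us k)).
  by move=> tsus; apply: (@provable_congr (nring_theory n)) => i; apply: tsus.
have Erefl t : E t t by apply: provable_refl.
have [|||||||||||||||R [f [fP f_surj f1 fadd fmul]]] :=
  @quotient_ring (term ring_sig r) E tzero tone (@topp r) (@tadd r) (@tmul r).
- exact: Erefl.
- by move=> t u; apply: provable_sym.
- by move=> t u w; apply: provable_trans.
- move=> t t' tt'.
  have := congr _ (topp (tvar 1 0)) [:: t] [:: t'].
  by rewrite !subst_ring; apply=> -[|[]].
- move=> t t' u u' tt' uu'.
  have := congr _ (tadd (tvar 2 0) (tvar 2 1)) [:: t; u] [:: t'; u'].
  by rewrite !subst_ring; apply=> -[|[|[]]].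
- move=> t t' u u' tt' uu'.
  have := congr _ (tmul (tvar 2 0) (tvar 2 1)) [:: t; u] [:: t'; u'].
  by rewrite !subst_ring; apply=> -[|[|[]]].
- by move=> t u w; have := inst _ _ _ [:: t; u; w] (nring_addA n);
    rewrite !subst_ring.
- by move=> t u; have := inst _ _ _ [:: t; u] (nring_addC n);
    rewrite !subst_ring.
- by move=> t; have := inst _ _ _ [:: t] (nring_add0 n); rewrite !subst_ring.
- by move=> t; have := inst _ _ _ [:: t] (nring_addN n); rewrite !subst_ring.
- by move=> t u w; have := inst _ _ _ [:: t; u; w] (nring_mulA n);
    rewrite !subst_ring.
- by move=> t; have := inst _ _ _ [:: t] (nring_mul1l n); rewrite !subst_ring.
- by move=> t; have := inst _ _ _ [:: t] (nring_mul1r n); rewrite !subst_ring.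
- by move=> t u w; have := inst _ _ _ [:: t; u; w] (nring_mulDl n);
    rewrite !subst_ring.
- by move=> t u w; have := inst _ _ _ [:: t; u; w] (nring_mulDr n);
    rewrite !subst_ring.
exists R, f; split=> // [x | t u /fP //].
have fpow t k : f (tpow t k) = f t ^+ k.
  case: k => [|k]; first by rewrite expr0.
  rewrite /tpow /iterop; elim: k => // k IH.
  by rewrite iteriS fmul IH [in RHS]exprS.
have [t ->] := f_surj x; rewrite -fpow; apply/fP.
by have := inst _ _ _ [:: t] (nring_pow n); rewrite !subst_ring.
Qed.

(** * Reducedness and central idempotents *)

Section Reduced.
Variables (R : pzRingType) (n : nat).
Hypotheses (n_gt1 : (1 < n)%N) (Xn : forall x : R, x ^+ n = x).

Lemma nring_reduced (x : R) : x * x = 0 -> x = 0.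
Proof.
by move=> xx0; rewrite -(Xn x) -(subnK n_gt1) exprD expr2 xx0 mulr0.
Qed.

(** Each of ex - exe and xe - exe squares to zero: [e] fixes it on one side and kills it on the
    other. *)
Lemma nring_idem_central (e x : R) : e * e = e -> GRing.comm e x.
Proof.
move=> ee; apply: (@etrans _ _ (e * x * e)).
  apply/subr0_eq/nring_reduced; set d := _ - _.
  have ed : e * d = d by rewrite mulrBr !mulrA ee.
  have de : d * e = 0 by rewrite mulrBl -[_ * e * e]mulrA ee subrr.
  by rewrite -{2}ed mulrA de mul0r.
symmetry; apply/subr0_eq/nring_reduced; set d := _ - _.
have de : d * e = d by rewrite mulrBl -!(mulrA _ e e) ee.
have ed : e * d = 0 by rewrite mulrBr !mulrA ee subrr.
by rewrite -{1}de -mulrA ed mulr0.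
Qed.

Lemma nring_pow_idem (x : R) : x ^+ n.-1 * x ^+ n.-1 = x ^+ n.-1.
Proof.
have n2K : (n - 2).+2 = n by rewrite -addn2 subnK.
have n1E : n.-1 = (n - 2).+1 by rewrite -[in LHS]n2K.
by rewrite -exprD n1E addnS -addSn n2K exprD Xn -exprS.
Qed.

End Reduced.

(** * Polynomials over F_p and finite fields *)

(** By Fermat's little theorem, 1 - (X - a)^(p-1) is 1 at a and 0 elsewhere on F_p. Both sides thus
    agree at p points, and their degrees are below p. *)
Lemma Fp_lagrangeX (p : nat) : prime p ->
  'X = \sum_(a : 'F_p) a *: (1 - ('X - a%:P) ^+ p.-1) :> {poly 'F_p}.
Proof.
move=> p_pr; have p_gt1 := prime_gt1 p_pr.
have p1_gt0 : (0 < p.-1)%N by rewrite -ltnS prednK // ltnW.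
apply/subr0_eq/eqP; set d := _ - _; apply: contraT => nz.
have size_d : (size d <= p)%N.
  rewrite (leq_trans (size_polyD _ _)) // size_polyN geq_max size_polyX p_gt1.
  apply: (leq_trans (size_sum _ _ _)); apply/bigmax_leqP => a _.
  rewrite (leq_trans (size_scale_leq _ _)) //.
  rewrite (leq_trans (size_polyD _ _)) // size_polyN geq_max size_poly1 ltnW //.
  by rewrite /= size_exp_XsubC prednK // ltnW.
suff /(max_poly_roots nz)/(_ (enum_uniq _)) : all (root d) (enum 'F_p).
  by rewrite -cardE card_Fp // ltnNge size_d.
apply/allP => b _; rewrite rootE hornerD hornerN hornerX horner_sum.
rewrite (bigD1 b) //= big1 ?addr0 => [|a ab].
  by rewrite !hornerE subrr expr0n eqn0Ngt p1_gt0 subr0 mulr1 subrr.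
rewrite !hornerE (_ : (b - a) ^+ _ = 1) ?subrr ?mulr0 //.
have ba : b - a != 0 by rewrite subr_eq0 eq_sym.
apply: (mulfI ba); rewrite -exprS prednK ?(ltnW p_gt1) // mulr1.
by rewrite -[X in _ ^+ X](card_Fp p_pr) expf_card.
Qed.

(** Strong induction on the size: a proper nonconstant divisor is smaller; if there is none, [f]
    divided by its leading coefficient is itself irreducible. *)
Lemma exists_irredp_factor (F : fieldType) (f : {poly F}) : (1 < size f)%N ->
  exists2 h, monic_irreducible_poly h & h %| f.
Proof.
have [m] := ubnP (size f); elim: m f => // m IH f le_f f_gt1.
have f_nz : f != 0 by rewrite -size_poly_gt0 ltnW.
have [[q [q1 qf nqf]]|irr] :=
  pselect (exists q : {poly F}, [/\ size q != 1, q %| f & ~~ (q %= f)]).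
  have q_nz : q != 0 by apply: contraNneq f_nz => q0; rewrite q0 dvd0p in qf.
  have q_lt : (size q < size f)%N.
    by rewrite ltn_neqAle dvdp_leq // andbT dvdp_size_eqp.
  have [||h hI hq] := IH q; last by exists h => //; apply: dvdp_trans qf.
  - exact: leq_trans q_lt _.
  - by rewrite ltn_neqAle eq_sym q1 size_poly_gt0.
pose c := (lead_coef f)^-1.
have c_nz : c != 0 by rewrite invr_eq0 lead_coef_eq0.
have cf : c *: f %= f by apply: eqp_scale.
exists (c *: f); last by rewrite (eqp_dvdl _ cf).
split; last by rewrite monicE lead_coefZ mulVf ?lead_coef_eq0.
split=> [|q q1]; first by rewrite size_scale.
rewrite (eqp_dvdr _ cf) (eqp_rtrans cf) => qf; apply: contraT => nqf.
by case: irr; exists q.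
Qed.

(** The unit group is cyclic; a generator [u] satisfies u^(n-1) = 1, and its order is the number of
    units. *)
Lemma finField_Xn_dvdn (F : finFieldType) (n : nat) : (0 < n)%N ->
  (forall x : F, x ^+ n = x) -> (#|F|.-1 %| n.-1)%N.
Proof.
move=> n_gt0 Xn.
have /cyclicP[u Du] := field_unit_group_cyclic [set: {unit F}].
rewrite -card_finField_unit Du -orderE order_dvdn.
apply/eqP/val_inj; rewrite FinRing.val_unitX /=.
apply: (mulfI (_ : val u != 0)); first by rewrite -unitfE (valP u).
by rewrite -exprS prednK // mulr1 Xn.
Qed.

Lemma in_qpoly_eq0 (F : fieldType) (h f : {poly F}) :
  monic_irreducible_poly h -> (in_qpoly h f == 0) = (h %| f).
Proof.
by move=> hI; rewrite -val_eqE /= mk_monicE // Pdiv.Field.dvdpE.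
Qed.

Lemma irredp_dvd_XpsubX (p n : nat) (h : {poly 'F_p}) :
    prime p -> simple_number n -> monic_irreducible_poly h ->
  (forall f : {poly 'F_p}, h %| f ^+ n - f) -> h %| 'X^p - 'X.
Proof.
move=> p_pr [n_gt1 simple_n] hI hn; pose F := {poly %/ h with hI}.
have cardF : #|F| = (p ^ (size h).-1)%N by rewrite card_qfpoly card_Fp.
have /finField_Xn_dvdn : forall x : F, x ^+ n = x.
  (* Elements of [F] are polynomials already reduced modulo [h], so [hn] applies to them
     directly. *)
  move=> x; have Dx : in_qpoly h x = x.
    by apply: val_inj; apply: (in_qpoly_small (size_mk_monic _)).
  apply/subr0_eq/eqP; rewrite -Dx -[_ ^+ n](rmorphXn (in_qpoly h)) -rmorphB.
  by rewrite in_qpoly_eq0.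
rewrite cardF -(subn1 (p ^ _)) -(subn1 n) ltnW // => /(_ isT)/simple_n.
(* The size is the degree plus one; [h] is nonconstant, so the exponent is at least 1, as
   [prime_power] demands. *)
have h1_gt0 : (0 < (size h).-1)%N by have [[]] := hI; case: size => [|[]].
have pp : prime_power (p ^ (size h).-1) by exists p, (size h).-1.
move=> /(_ pp) pr_q; rewrite -in_qpoly_eq0 // rmorphB rmorphXn /= subr_eq0.
have cardFp : #|F| = p.
  by rewrite cardF; apply/esym/eqP; rewrite -dvdn_prime2 // dvdn_exp.
have := expf_card (in_qpoly h 'X : F); rewrite cardFp => XpX.
by apply/eqP; apply: XpX.
Qed.

(** * Prime characteristic *)

Section CharP.
Variables (R : nzRingType) (p : nat).
Hypothesis pR : p \in [pchar R].

Lemma pring_commutative :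
  (forall x : R, x ^+ p = x) -> forall x y : R, x * y = y * x.
Proof.
move=> Xp; have p_pr := pcharf_prime pR.
(* [A] is [R] viewed as an F_p-algebra, so that the interpolation identity can be evaluated at
   [x]. *)
pose A := pPrimeCharType pR; move=> x y; apply: commr_sym.
have /(congr1 (horner_alg (x : A))) := Fp_lagrangeX p_pr.
rewrite horner_algX rmorph_sum => -> /=.
apply: commr_sum => a _.
rewrite linearZ /= mulr_algl rmorphB rmorph1 rmorphXn /=.
set u : A := horner_alg _ _.
(* As y^p = y throughout [R], the power u^(p-1) is idempotent, hence central. *)
have uy : u ^+ p.-1 * (y : A) = y * u ^+ p.-1.
  apply: (nring_idem_central (prime_gt1 p_pr) Xp).
  exact: (nring_pow_idem (prime_gt1 p_pr) Xp).
have yZ (v : A) : y * v = v * (y : A) -> (y : A) * (a *: v) = a *: v * (y : A).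
  by move=> yv; rewrite -scalerAl -scalerAr yv.
by apply: yZ; rewrite mulrBr mulrBl mulr1 mul1r uy.
Qed.

Lemma nring_pring n : simple_number n ->
  (forall x : R, x ^+ n = x) -> forall x : R, x ^+ p = x.
Proof.
move=> simple_n Xn x; have n_gt1 := simple_n.1.
have p_pr := pcharf_prime pR.
pose ev := horner_alg (x : pPrimeCharType pR).
have ev_Xn m f : ev (f ^+ m) = ev f ^+ m by rewrite /ev rmorphXn.
have evM f g : ev (f * g) = ev f * ev g by rewrite /ev rmorphM.
have evB f g : ev (f - g) = ev f - ev g by rewrite /ev rmorphB.
have evX : ev 'X = x by apply: horner_algX.
(* Since X^n - X vanishes at [x], a nonzero annihilating polynomial of least size exists; it serves
   as minimal polynomial, up to a scalar. *)
have ex_size : exists m, `[< exists g, [/\ g != 0, ev g = 0 & size g = m] >].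
  exists (size ('X^n - 'X : {poly 'F_p})); apply/asboolP.
  exists ('X^n - 'X); split=> //; last by rewrite evB ev_Xn evX Xn subrr.
  rewrite -size_poly_gt0 size_polyDl ?size_polyXn // size_polyN size_polyX.
  by rewrite ltnS.
case: (ex_minnP ex_size) => _ /asboolP[g [g_nz evg <-]] g_min.
(* The remainder of [f] modulo [g] also vanishes at [x] and is smaller than [g], so it is zero. *)
have dvd_g f : ev f = 0 -> g %| f.
  move=> evf; rewrite /dvdp; apply: contraT => nz.
  suff: (size g <= size (f %% g)%R)%N by rewrite leqNgt ltn_modpN0.
  apply/g_min/asboolP; exists (f %% g); split=> //.
  by rewrite (_ : f %% g = f - f %/ g * g) ?evB ?evf ?evM ?evg ?mulr0 ?subrr //
    [X in X - _](divp_eq f g) addrC addKr.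
suff /dvdpP[q Dq] : g %| 'X^p - 'X.
  by apply/subr0_eq; rewrite -evX -ev_Xn -evB Dq evM evg mulr0.
pose d := gcdp g ('X^p - 'X); have d_g : d %| g by apply: dvdp_gcdl.
have /dvdpP[q Dg] := d_g.
have q_nz : q != 0 by apply: contraNneq g_nz => q0; rewrite Dg q0 mul0r.
(* If q is not constant, then some irreducible h divides both q and d; then
   u := g / h has u(x)^2 = 0, contradicting the minimality of g. *)
have [q_gt1 | q_le1] := ltnP 1 (size q); last first.
  have /size_poly1P[c c_nz Dc] : size q == 1.
    by rewrite eqn_leq q_le1 size_poly_gt0.
  by rewrite Dg Dc mul_polyC dvdpZl // dvdp_gcdr.
have [h hI hq] := exists_irredp_factor q_gt1.
have hg : h %| g by rewrite Dg dvdp_mulr.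
(* Every f^n - f vanishes at [x], hence is divisible by [g] and so by [h]. *)
have hd : h %| d.
  rewrite dvdp_gcd hg (irredp_dvd_XpsubX p_pr simple_n hI) // => f.
  by apply: dvdp_trans hg (dvd_g _ _); rewrite evB ev_Xn Xn subrr.
have /dvdpP[q' Dq] := hq; have /dvdpP[d' Dd] := hd.
have [[h_gt1 _] _] := hI.
pose u := h * (q' * d').
have Dgu : g = h * u by rewrite Dg Dq Dd /u; ring.
have evu : ev u = 0.
  apply: (nring_reduced n_gt1 Xn); rewrite -evM.
  have -> : u * u = g * (q' * d') by rewrite Dgu /u; ring.
  by rewrite evM evg mul0r.
have u_nz : u != 0 by apply: contraNneq g_nz => u0; rewrite Dgu u0 mulr0.
have h_nz : h != 0 by rewrite -size_poly_gt0 ltnW.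
(* This bounds the size of [g] by that of [u], but size g = size h + size u - 1 and size h > 1. *)
have := dvdp_leq u_nz (dvd_g _ evu).
rewrite {1}Dgu size_mul // -subn1 -addnBAC ?size_poly_gt0 // subn1.
rewrite -[leqRHS]add0n leq_add2r leqNgt -ltnS prednK ?h_gt1 //.
exact: ltnW.
Qed.

End CharP.

(** * Reduction to prime characteristic *)

Lemma nring_commutative_pchar (R : pzRingType) (n p : nat) :
    simple_number n -> (forall x : R, x ^+ n = x) -> prime p ->
  p%:R = 0 :> R -> forall x y : R, x * y = y * x.
Proof.
(* The zero ring is treated first, as the results in prime characteristic assume a nonzero ring. *)
move=> simple_n Xn p_pr pR0 x y; have [R0 | R_nz] := eqVneq (1 : R) 0.
  by rewrite -[x]mulr1 -[y]mulr1 R0 !mulr0.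
pose S : nzRingType := HB.pack (GRing.PzRing.sort R)
  (GRing.PzSemiRing_isNonZero.Build R R_nz).
have pS : p \in [pchar S] by rewrite inE p_pr; apply/eqP.
exact: (@pring_commutative S p pS (nring_pring pS simple_n Xn)).
Qed.

(* S is the quotient R/Ann(c). *)
Lemma natmul_quotient (R : pzRingType) (c : nat) :
  exists (S : pzRingType) (f : {rmorphism R -> S}),
  (forall s, exists x, s = f x) /\ forall x y, x *+ c = y *+ c <-> f x = f y.
Proof.
have [|||||||||||||||S [f [fP f_surj f1 fD fM]]] :=
  @quotient_ring R (fun x y => x *+ c = y *+ c) 0 1 -%R +%R *%R.
- by [].
- by move=> x y ->.
- by move=> x y z -> ->.
- by move=> x x' xx'; rewrite !mulNrn xx'.
- by move=> x x' y y' xx' yy'; rewrite !mulrnDl xx' yy'.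
- move=> x x' y y' xx' yy'.
  by rewrite -mulrnAl xx' mulrnAl -mulrnAr yy' mulrnAr.
- by move=> x y z; rewrite addrA.
- by move=> x y; rewrite addrC.
- by move=> x; rewrite add0r.
- by move=> x; rewrite addNr.
- by move=> x y z; rewrite mulrA.
- by move=> x; rewrite mul1r.
- by move=> x; rewrite mulr1.
- by move=> x y z; rewrite mulrDl.
- by move=> x y z; rewrite mulrDr.
have fB : zmod_morphism f.
  by move=> x y; apply: (addIr (f y)); rewrite -fD !subrK.
pose g : {rmorphism R -> S} := HB.pack f
  (GRing.isZmodMorphism.Build R S f fB)
  (GRing.isMonoidMorphism.Build R S f (conj f1 fM)).
by exists S, g.
Qed.

(** In R/Ann(c) the image of [p] vanishes, so that quotient is commutative and [c] kills every
    commutator of [R]. *)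
Lemma commutator_natmul (R : pzRingType) (n c p : nat) (x y : R) :
    simple_number n -> (forall x : R, x ^+ n = x) -> prime p ->
  (p * c)%:R = 0 :> R -> (x * y - y * x) *+ c = 0.
Proof.
move=> simple_n Xn p_pr pc0.
have [S [f [f_surj fP]]] := natmul_quotient R c.
have XnS (s : S) : s ^+ n = s by have [t ->] := f_surj s; rewrite -rmorphXn Xn.
have pS0 : p%:R = 0 :> S.
  by rewrite -(rmorph_nat f) -(rmorph0 f); apply/fP; rewrite -mulrnA pc0 mul0rn.
rewrite -(mul0rn R c); apply/fP; rewrite rmorphB !rmorphM rmorph0.
by rewrite (nring_commutative_pchar simple_n XnS p_pr pS0) subrr.
Qed.

(** If a commutator [z] had additive order j > 1, a prime p dividing j would divide the
    characteristic k. As k/p kills [z], p would divide k/p too, which reducedness forbids. *)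
Lemma nring_commutative (R : pzRingType) (n : nat) : simple_number n ->
  (forall x : R, x ^+ n = x) -> forall x y : R, x * y = y * x.
Proof.
move=> simple_n Xn x y; have n_gt1 := simple_n.1.
(* The power law at the element 2 gives 2^n - 2 = 0 in [R]. *)
have ex_char : exists k, (0 < k)%N && (k%:R == 0 :> R).
  have lt2 : (2 < 2 ^ n)%N by rewrite -[X in (X < _)%N]expn1 ltn_exp2l.
  exists (2 ^ n - 2)%N; rewrite subn_gt0 lt2.
  by rewrite natrB ?natrX ?Xn ?subrr ?eqxx // ltnW.
case: (ex_minnP ex_char) => k /andP[k_gt0 /eqP k0] k_min.
pose z := x * y - y * x.
have ex_ord : exists j, (0 < j)%N && (z *+ j == 0).
  by exists k; rewrite k_gt0 -mulr_natr k0 mulr0 eqxx.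
case: (ex_minnP ex_ord) => j /andP[j_gt0 /eqP zj] j_min.
have j_dvd i : z *+ i = 0 -> (j %| i)%N.
  move=> zi; rewrite /dvdn -leqn0 leqNgt; apply/negP => r_gt0.
  have := j_min (i %% j)%N; rewrite r_gt0 leqNgt ltn_mod j_gt0 /=.
  suff -> : z *+ (i %% j) == 0 by move/(_ isT).
  move: zi; rewrite {1}(divn_eq i j) mulrnDr mulnC mulrnA zj mul0rn add0r.
  by move=> ->.
have [j_le1 | j_gt1] := leqP j 1.
  have j1 : j = 1%N by apply/eqP; rewrite eqn_leq j_le1.
  by apply: subr0_eq; rewrite j1 in zj.
have p_pr := pdiv_prime j_gt1; set p := pdiv j in p_pr.
have pj : (p %| j)%N by apply: pdiv_dvd.
have jk : (j %| k)%N by apply: j_dvd; rewrite -mulr_natr k0 mulr0.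
have /dvdnP[c Dk] := dvdn_trans pj jk.
have zc : z *+ c = 0.
  by apply: (commutator_natmul _ _ simple_n Xn p_pr); rewrite mulnC -Dk.
have /dvdnP[e Dc] := dvdn_trans pj (j_dvd _ zc).
have c_gt0 : (0 < c)%N by move: k_gt0; rewrite Dk muln_gt0 => /andP[].
(* From c = ep follows c^2 = ek, which is 0 in [R]; then c = 0 in [R] contradicts the minimality of
   [k]. *)
have cR0 : c%:R = 0 :> R.
  apply: (nring_reduced n_gt1 Xn); rewrite -natrM {1}Dc -mulnA (mulnC _ c) -Dk.
  by rewrite natrM k0 mulr0.
have := k_min c; rewrite c_gt0 cR0 eqxx => /(_ isT).
by rewrite Dk leqNgt ltn_Pmulr // prime_gt1.
Qed.

Theorem theorem1p4 (n : nat) (hn : simple_number n) :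
  @provable (nring_theory n) 2
    (tmul (tvar 2 0) (tvar 2 1)) (tmul (tvar 2 1) (tvar 2 0)).
Proof.
have [R [f [Xn fM f_inj]]] := free_nring n 2.
by apply: f_inj; rewrite !fM; apply: nring_commutative hn Xn _ _.
Qed.
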